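(* Let $e,l\in\mathbb{Z}_{>0}$, let $\boldsymbol{\lambda}$ be an $l$-partition and let ${\bf s}\in\mathbb{N}^l$. Set $X:=X^{1,{\bf s}}(\boldsymbol{\lambda})$, let $X^{\circ}$ be the $e$-core of $X$ and let ${\bf s}^{\circ}$ be the multicharge of $X^{\circ}$. Then, as multisets, the non-zero elements of $$|\mathcal{HL}^{CJ}(X^{\circ})|\cup\mathcal{HL}^{BGO}(X^{1,{\bf s}^{\circ}}(\boldsymbol{\emptyset}))$$ are contained in $$|\mathcal{HL}^{CJ}(X)|\cup\mathcal{HL}^{BGO}(X^{1,{\bf s}}(\boldsymbol{\emptyset})).$$ In particular, for ${\bf s}=\boldsymbol{0}=(0,\ldots,0)$, the elements of $|\mathcal{HL}^{CJ}(X^{\circ})|$ are contained in $|\mathcal{HL}^{CJ}(X)|$ (as multisets).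
   Context: $\mathbb{N}=\mathbb{Z}_{\ge 0}$. A $\beta$-set of charge $m$ is a finite strictly increasing sequence $(a_1,\ldots,a_m)$ of elements of $\mathbb{N}$, identified with the set of its entries. An $l$-symbol is an $l$-tuple $X=(X_1,\ldots,X_l)$ of $\beta$-sets; its multicharge is the $l$-tuple of the charges of $X_1,\ldots,X_l$. Set $\Gamma_j=\mathbb{N}\setminus X_j$. Hooks. A hook in $X$ is a quadruple $(a,b,i,j)$ with $a\in X_i$, $b\in\Gamma_j$, $1\le i,j\le l$; its hook length is $a-b$. It is a BGO-hook if $a\ge b$ and, when $a=b$, $i>j$. It is a CJ-hook if $\sharp\{\gamma\in\Gamma_i\mid a>\gamma\}>\sharp\{\gamma\in\Gamma_j\mid b>\gamma\}$. $\mathcal{HL}^{BGO}(X)$ and $\mathcal{HL}^{CJ}(X)$ denote the multisets of hook lengths of all BGO-hooks, respectively all CJ-hooks, in $X$. For a multiset $M$ of integers, $|M|$ is the multiset of absolute values of its elements; $\cup$ is union of multisets with multiplicities added. Symbols of multipartitions. An $l$-partition is an $l$-tuple $\boldsymbol{\lambda}=(\lambda^1,\ldots,\lambda^l)$ of partitions (padded by zeros). Let $m_j:=\min\{i>0\mid\lambda^j_i=0\}$ and $m:=\max_j m_j$. Then $X^{1,\boldsymbol{0}}(\boldsymbol{\lambda})$ is the $l$-symbol of multicharge $(m,\ldots,m)$ whose $j$-th component is $\{\lambda^j_i-i+m\mid 1\le i\le m\}$. For a $\beta$-set $Y=(a_1,\ldots,a_r)$ and $s\in\mathbb{N}$, $Y[s]:=(0,1,\ldots,s-1,a_1+s,\ldots,a_r+s)$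 (and $Y[0]=Y$). For ${\bf s}=(s_1,\ldots,s_l)\in\mathbb{N}^l$, $X^{1,{\bf s}}(\boldsymbol{\lambda})$ is the $l$-symbol with $j$-th component $X^{1,\boldsymbol{0}}(\boldsymbol{\lambda})_j[s_j]$. Empty multipartition. $X^{1,{\bf s}}(\boldsymbol{\emptyset})$ denotes the symbol whose $j$-th component is an initial segment $\{0,1,\ldots,n_j-1\}$ of $\mathbb{N}$, where $(n_1,\ldots,n_l)$ is the multicharge of $X=X^{1,{\bf s}}(\boldsymbol{\lambda})$, and $X^{1,{\bf s}^\circ}(\boldsymbol{\emptyset})$ denotes the analogous symbol with the same multicharge ${\bf s}^\circ$ as $X^\circ$. The $e$-core $X^{\circ}$ of an $l$-symbol $X$ is obtained by applying the following operations as long as possible (the result does not depend on the choices made): (1) if $(a,a,i,j)$ is a hook with $i<j$, replace $X_i$ by $X_i\setminus\{a\}$ and $X_j$ by $X_j\cup\{a\}$; (2) if $(a,a-e,l,1)$ is a hook, replace $X_l$ by $X_l\setminus\{a\}$ and $X_1$ by $X_1\cup\{a-e\}$. *)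

(* Defs.v *)
From Stdlib Require Export Relation_Operators.
From mathcomp Require Export all_boot all_order all_algebra.
From mathcomp Require Export finmap multiset.

Set Implicit Arguments.
Unset Strict Implicit.
Unset Printing Implicit Defensive.

Open Scope mset_scope.
Open Scope fset_scope.
Open Scope nat_scope.

(* A beta-set is identified with its set of entries, so its charge is its
   cardinality. The components X_1, ..., X_l are indexed by 0, ..., l - 1. *)
Definition symbol (l : nat) := {ffun 'I_l -> {fset nat}}.

Definition multicharge l (X : symbol l) : {ffun 'I_l -> nat} :=
  [ffun j => #|` X j|].

Definition is_gap l (X : symbol l) (j : 'I_l) (b : nat) : bool := b \notin X j.

Definition gaps_below l (X : symbol l) (j : 'I_l) (b : nat) : nat :=
  count (is_gap X j) (iota 0 b).

Notation quad l := (nat * nat * 'I_l * 'I_l)%type.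

Definition is_hook l (X : symbol l) (h : quad l) : bool :=
  let: (a, b, i, j) := h in (a \in X i) && is_gap X j b.

Definition hook_length l (h : quad l) : int :=
  let: (a, b, _, _) := h in (a%:Z - b%:Z)%R.

Definition is_BGO_hook l (X : symbol l) (h : quad l) : bool :=
  let: (a, b, i, j) := h in
  [&& is_hook X h, b <= a & (a == b) ==> (j < i)].

Definition is_CJ_hook l (X : symbol l) (h : quad l) : bool :=
  let: (a, b, i, j) := h in
  is_hook X h && (gaps_below X j b < gaps_below X i a).

(* A finite box of quadruples containing all BGO-hooks and all CJ-hooks, as
   [mem_BGO_hooks] and [mem_CJ_hooks] below show. *)
Definition hook_bound l (X : symbol l) : nat :=
  (\max_(i < l) \max_(a <- X i) a + \max_(j < l) #|` X j|).+1.

Definition hook_box l (X : symbol l) : seq (quad l) :=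
  let r := iota 0 (hook_bound X) in
  [seq (p, q.1, q.2) | p <- [seq (a, b) | a <- r, b <- r],
                       q <- enum {: 'I_l * 'I_l}].

Definition BGO_hooks l (X : symbol l) : {fset quad l} :=
  [fset h in hook_box X | is_BGO_hook X h].

Definition CJ_hooks l (X : symbol l) : {fset quad l} :=
  [fset h in hook_box X | is_CJ_hook X h].

Definition HL_BGO l (X : symbol l) : {mset int} :=
  seq_mset [seq hook_length h | h <- BGO_hooks X].

Definition HL_CJ l (X : symbol l) : {mset int} :=
  seq_mset [seq hook_length h | h <- CJ_hooks X].

Definition mset_abs (M : {mset int}) : {mset int} :=
  seq_mset [seq `|x|%R | x <- M].

Definition mset_nonzero (M : {mset int}) : {mset int} :=
  seq_mset [seq x <- M | x != 0%R].

Definition is_partition (p : seq nat) : bool := sorted geq p && (0 \notin p).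

(* The parts lambda_i, numbered from i = 1 and padded by zeros. *)
Definition part (p : seq nat) (i : nat) : nat := nth 0 p i.-1.

Lemma part_zero_ex (p : seq nat) : exists i, (0 < i) && (part p i == 0).
Proof. by exists (size p).+1; rewrite /part /= nth_default. Qed.

Definition first_zero (p : seq nat) : nat := ex_minn (part_zero_ex p).

Definition base_charge l (lam : 'I_l -> seq nat) : nat :=
  \max_(j < l) first_zero (lam j).

Definition shift_bset (Y : {fset nat}) (s : nat) : {fset nat} :=
  [fset k in iota 0 s] `|` [fset a + s | a in Y].

(* [part p i + (m - i)] is lambda_i - i + m, written without truncation. *)
Definition symbol0_of l (lam : 'I_l -> seq nat) : symbol l :=
  let m := base_charge lam in
  [ffun j => [fset part (lam j) i + (m - i) | i in iota 1 m]].

Definition symbol_of l (s : 'I_l -> nat) (lam : 'I_l -> seq nat) : symbol l :=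
  [ffun j => shift_bset (symbol0_of lam j) (s j)].

(* The symbol of the empty multipartition with multicharge n. *)
Definition empty_symbol l (n : 'I_l -> nat) : symbol l :=
  [ffun j => [fset k in iota 0 (n j)]].

(* Removal comes first: the two indices may coincide when l = 1. *)
Definition move_bead l (X : symbol l) (h : quad l) : symbol l :=
  let: (a, b, i, j) := h in
  let Y := [ffun k => if k == i then X k `\ a else X k] in
  [ffun k => if k == j then b |` Y k else Y k].

Inductive core_step (e l : nat) (X : symbol l) : symbol l -> Prop :=
| core_step_up a (i j : 'I_l) :
    i < j -> is_hook X (a, a, i, j) ->
    core_step e X (move_bead X (a, a, i, j))
| core_step_wrap a (i j : 'I_l) :
    val i = l.-1 -> val j = 0 -> e <= a -> is_hook X (a, a - e, i, j) ->
    core_step e X (move_bead X (a, a - e, i, j)).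

Definition is_ecore_of (e l : nat) (X Z : symbol l) : Prop :=
  clos_refl_trans _ (@core_step e l) X Z /\ forall Y, ~ core_step e Z Y.

Lemma mem_hook_box l (X : symbol l) a b i j :
  (((a, b, i, j) : quad l) \in hook_box X) =
  (a < hook_bound X) && (b < hook_bound X).
Proof.
apply/allpairsP/andP.
  case=> -[p [q1 q2]] [] /allpairsP[] [a1 b1] [] la lb -> _ [-> -> _ _].
  by rewrite !mem_iota in la lb.
move=> [la lb]; exists ((a, b), (i, j)); split; rewrite ?mem_enum //.
by apply/allpairsP; exists (a, b); rewrite !mem_iota.
Qed.

Lemma hook_in_box l (X : symbol l) a b i j :
  a \in X i -> b <= a + #|` X j| -> ((a, b, i, j) : quad l) \in hook_box X.
Proof.
move=> aX le_b; rewrite mem_hook_box !ltnS.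
have le_a : a <= \max_(i < l) \max_(a <- X i) a.
  apply: leq_trans (leq_bigmax i); exact: leq_bigmax_seq.
rewrite (leq_trans le_a (leq_addr _ _)) (leq_trans le_b) // leq_add //.
exact: (leq_bigmax j).
Qed.

Lemma leq_gaps_below l (X : symbol l) j b : b <= gaps_below X j b + #|` X j|.
Proof.
rewrite -[X in X <= _](size_iota 0 b) -(count_predC (is_gap X j)) leq_add2l.
rewrite -size_filter uniq_leq_size ?filter_uniq ?iota_uniq // => x.
by rewrite mem_filter /= /is_gap negbK => /andP[].
Qed.

Lemma mem_BGO_hooks l (X : symbol l) (h : quad l) :
  (h \in BGO_hooks X) = is_BGO_hook X h.
Proof.
rewrite !inE /=; case: (boolP (is_BGO_hook X h)); last by rewrite andbF.
case: h => [[[a b] i] j] /and3P[/andP[aX _] le_ba _].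
by rewrite andbT hook_in_box // (leq_trans le_ba) ?leq_addr.
Qed.

Lemma mem_CJ_hooks l (X : symbol l) (h : quad l) :
  (h \in CJ_hooks X) = is_CJ_hook X h.
Proof.
rewrite !inE /=; case: (boolP (is_CJ_hook X h)); last by rewrite andbF.
case: h => [[[a b] i] j] /andP[/andP[aX _] lt_ba].
rewrite andbT hook_in_box // (leq_trans (leq_gaps_below X j b)) // leq_add2r.
rewrite (leq_trans (ltnW lt_ba)) // -[X in _ <= X](size_iota 0 a).
exact: count_size.
Qed.

Lemma move_measure l (X : symbol l) (c : nat -> 'I_l -> nat) a b i j :
  is_hook X (a, b, i, j) ->
  \sum_(k < l) \sum_(x <- move_bead X (a, b, i, j) k) c x k + c a i =
  \sum_(k < l) \sum_(x <- X k) c x k + c b j.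
Proof.
move=> /andP[aX bX]; rewrite /is_gap in bX.
set Y := [ffun k => if k == i then X k `\ a else X k] : symbol l.
have eY : \sum_(k < l) \sum_(x <- Y k) c x k + c a i =
          \sum_(k < l) \sum_(x <- X k) c x k.
  rewrite (bigD1 i) //= [RHS](bigD1 i) //= ffunE eqxx [in RHS](big_fsetD1 a) //=.
  rewrite addnAC [X in X + _]addnC; congr (_ + _).
  by apply: eq_bigr => k /negPf ne; rewrite ffunE ne.
have bY : b \notin Y j.
  by rewrite ffunE; case: eqP => _ //; rewrite !inE negb_and bX orbT.
rewrite -eY -[RHS]addnAC; congr (_ + _).
rewrite (bigD1 j) //= [in RHS](bigD1 j) //= ffunE eqxx big_fsetU1 //=.
rewrite [RHS]addnC addnA; congr (_ + _).
by apply: eq_bigr => k /negPf ne; rewrite ffunE ne.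
Qed.

Lemma is_ecore_of_exists e l (X : symbol l) :
  0 < e -> 0 < l -> exists Z, is_ecore_of e X Z.
Proof.
move=> e_gt0 l_gt0; pose c (x : nat) (k : 'I_l) := x * l + (l.-1 - k).
have [n] := ubnP (\sum_(k < l) \sum_(x <- X k) c x k).
elim: n X => // n IHn X /ltnSE le_n.
have IH Y : core_step e X Y -> exists Z, is_ecore_of e X Z.
  move=> XY; have [Z [YZ endZ]] : exists Z, is_ecore_of e Y Z; last first.
    by exists Z; split=> //; apply: rt_trans YZ; apply: rt_step.
  apply/IHn/(leq_trans _ le_n); case: Y / XY.
    move=> a i j lt_ij /(move_measure c) E.
    rewrite -(ltn_add2r (c a i)) E ltn_add2l /c ltn_add2l ltn_sub2l //.
    by rewrite (leq_trans lt_ij) // -ltnS prednK.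
  move=> a i j ei ej le_ea /(move_measure c) E.
  rewrite -(ltn_add2r (c a i)) E ltn_add2l /c ei ej subnn addn0 subn0.
  rewrite mulnBl; have := leq_mul le_ea (leqnn l); have: l <= e * l.
    by rewrite leq_pmull.
  move=> le1 le2; rewrite -{2}(subnK le2) ltn_add2l.
  by apply: leq_trans le1; rewrite prednK.
have lt_last : l.-1 < l by rewrite prednK.
pose last := Ordinal lt_last; pose first := Ordinal l_gt0.
pose P (h : quad l) := let: (a, b, i, j) := h in
  is_hook X h && ((a == b) && (i < j) ||
                  [&& i == last, j == first, e <= a & b == a - e]).
have [/hasP[[[[a b] i] j] _ /andP[hk /orP[]]]|/hasPn no_hook] :=
    boolP (has P (hook_box X)).
- move=> /andP[/eqP eb lt_ij]; rewrite -eb in hk.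
  exact: IH (core_step_up e lt_ij hk).
- move=> /and4P[/eqP ei /eqP ej le_ea /eqP eb].
  rewrite ei ej eb in hk; exact: IH (core_step_wrap _ _ le_ea hk).
exists X; split; first exact: rt_refl.
move=> Y XY; case: Y / XY.
  move=> a i j lt_ij hk; have /andP[aX _] := hk.
  have /negP[] := no_hook _ (hook_in_box aX (leq_addr #|` X j| a)).
  by rewrite /P hk eqxx lt_ij.
move=> a i j ei ej le_ea hk; have /andP[aX _] := hk.
have le_b := leq_trans (leq_subr e a) (leq_addr #|` X j| a).
have /negP[] := no_hook _ (hook_in_box aX le_b).
by rewrite /P hk le_ea eqxx -!val_eqE /= ei ej !eqxx orbT.
Qed.

(* Main.v *)
Require Import Defs.
From mathcomp Require Import zify.

(** Fix a length k > 0 and write N_k(X) for the number of pairs of an entry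
a of a component X_i and a gap a - k of a component X_j, that is, for the
multiplicity of k in HL^BGO(X). The theorem rests on two facts, which hold
for every l-symbol X, not only for those attached to multipartitions.

The first ([HL_CJ_BGO_empty]) is the equality
   |HL^CJ(X)| u HL^BGO(empty symbol with the charges of X) = HL^BGO(X)
of multiplicities at every k > 0. For fixed i and j put
H(a) = gaps_i(a) - gaps_j(a - k) and let a grow from k. The function H goes
down by one exactly at the hooks (a, a - k, i, j), up by one exactly at the
hooks (a - k, a, j, i), and is constant elsewhere. The former are BGO-hooks,
and CJ-hooks if H(a) > 0; the latter are CJ-hooks if H(a) < 0. So the BGO-hooks
that fail to be CJ-hooks, less the CJ-hooks that run the other way, count the
net descent of min(H, 0). It starts at 0, since H(k) = gaps_i(k), and ends at
min(n_j + k - n_i, 0), where n_i and n_j are the charges. Hence the discrepancy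
depends on the charges only, and it can be read off from the empty symbol,
which has no CJ-hook at all.

The second ([ecore_HL_BGO]) is N_k(Xo) <= N_k(X), where Xo is the e-core of X. A
single operation may increase N_k, so X and Xo are compared directly. In each
residue class modulo e, let p_i count the entries of X_i and let q_j count
those of X_j + k. The hooks (a, a - k, i, j) with a in the class number at least
p_i - (t + q_j), truncated at 0, where t counts the a < k in the class. For Xo
equality holds: there an entry a of any component forces a - e into every
component, so that the sets involved are initial segments of the class and are
comparable. The sums of the p_i and of the q_j over all components are the same
for X and Xo, while for Xo the p_i differ by at most one, and so do the q_j.
Since the truncated difference is convex in each argument, these balanced values
minimise the double sum of p_i - (t + q_j) ([balanced_min_excess]).

For the last assertion, Xo has no CJ-hook of length 0, as its components
increase with their index, and at zero shifts all the charges of X agree, so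
that the BGO-hooks of the empty symbol have length 0. *)

Set Implicit Arguments.
Unset Strict Implicit.
Unset Printing Implicit Defensive.

(** * Hook multisets as counts over intervals *)

(** Turns the count of hooks of a fixed length into sums of counts over an
interval, one for each pair of components: [f] lists the pairs of positions at
the prescribed distance. *)
Lemma count_fset_quads l (S : {fset quad l}) (P : pred (quad l))
    (f : nat -> nat * nat) (M : nat) :
  injective f ->
  (forall h, h \in S -> P h -> exists2 a, a < M & h.1.1 = f a) ->
  count P S =
  \sum_(i < l) \sum_(j < l)
    count (fun a => ((f a, i, j) \in S) && P (f a, i, j)) (iota 0 M).
Proof.
move=> injf fP.
pose T : seq (quad l) :=
  [seq (f p.2, p.1.1, p.1.2) | p <- [seq (q, a) | q <- enum {: 'I_l * 'I_l},
                                                  a <- iota 0 M]].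
have uniqT : uniq T.
  rewrite map_inj_uniq; last by move=> [[i j] a] [[i' j'] a'] [/injf -> -> ->].
  by apply: allpairs_uniq; rewrite ?enum_uniq ?iota_uniq // => -[? ?] [? ?].
have sumE F : \sum_(i < l) \sum_(j < l)
                count (fun a => F (f a, i, j)) (iota 0 M)
              = count F T.
  rewrite -[RHS]sum1_count big_map [RHS]big_mkcond big_allpairs big_enum /=.
  rewrite pair_bigA; apply: eq_bigr => q _ /=.
  by rewrite -sum1_count big_mkcond.
rewrite (sumE (fun h => (h \in S) && P h)) -!size_filter.
apply/perm_size/uniq_perm; rewrite ?filter_uniq ?fset_uniq // => h.
rewrite !mem_filter andbC; case: (boolP (h \in S)) => //= hS; rewrite andbC.
case: (boolP (P h)); last by rewrite andbF.
rewrite andbT => /(fP h hS)[a ltaM eqh]; symmetry; apply/mapP.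
exists ((h.1.2, h.2), a); last by case: h eqh {hS} => [[? ?] ?] /= ->.
by apply/allpairsP; exists ((h.1.2, h.2), a); rewrite mem_enum mem_iota.
Qed.

Lemma HL_BGO_count l (X : symbol l) (x : int) :
  HL_BGO X x = count (fun h => hook_length h == x) (BGO_hooks X).
Proof. by rewrite /HL_BGO mset_seqE count_map. Qed.

Lemma mset_abs_HL_CJ_count l (X : symbol l) (x : int) :
  mset_abs (HL_CJ X) x = count (fun h => `|hook_length h|%R == x) (CJ_hooks X).
Proof.
rewrite /mset_abs mset_seqE count_map /HL_CJ.
by rewrite (permP (perm_eq_seq_mset _)) count_map.
Qed.

Lemma mset_nonzeroE (M : {mset int}) (x : int) :
  mset_nonzero M x = if x == 0%R then 0 else M x.
Proof.
rewrite /mset_nonzero mset_seqE count_filter -(count_mem_mset x M).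
have [->|x_neq0] := eqVneq x 0%R.
  rewrite -(count_pred0 M); apply: eq_count => y /=.
  by case: (eqVneq y 0%R).
apply: eq_count => y /=; case: (eqVneq y x) => //= ->; by rewrite x_neq0.
Qed.

(** Hooks of length k > 0 are indexed by their upper position. *)
Definition down_hooks l (X : symbol l) (k M : nat) (i j : 'I_l) : nat :=
  count (fun a => [&& k <= a, a \in X i & a - k \notin X j]) (iota 0 M).

Lemma HL_BGO_down_hooks l (X : symbol l) (k M : nat) :
  0 < k -> hook_bound X <= M ->
  HL_BGO X (Posz k) = \sum_(i < l) \sum_(j < l) down_hooks X k M i j.
Proof.
move=> k_gt0 leM.
rewrite HL_BGO_count (@count_fset_quads _ _ _ (fun a => (a, a - k)) M).
- apply: eq_bigr => i _; apply: eq_bigr => j _; apply: eq_count => a.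
  rewrite mem_BGO_hooks /= /is_gap; case: (a \in X i) => /=;
    last by rewrite andbF.
  by case: (a - k \in X j) => /=; rewrite ?andbF //; lia.
- by move=> a b [].
move=> [[[a b] i] j] /[dup] hS.
rewrite mem_BGO_hooks => /and3P[/andP[aX _] _ _].
rewrite /hook_length => /eqP eq_k.
have := hook_in_box aX (leq_addr #|` X j| a).
rewrite mem_hook_box => /andP[lt_a _].
by exists a; rewrite ?(leq_trans lt_a) //=; congr (_, _); lia.
Qed.

(** The CJ-hooks of length k and those of length -k are both indexed by their
upper position a; the latter are the hooks (a - k, a, j, i), with the components
in the opposite order, so that both kinds can be compared at the same i and j. *)
Definition CJ_down l (X : symbol l) (k M : nat) (i j : 'I_l) : nat :=
  count (fun a => [&& k <= a, a \in X i, a - k \notin X j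
                    & gaps_below X j (a - k) < gaps_below X i a]) (iota 0 M).

Definition CJ_up l (X : symbol l) (k M : nat) (i j : 'I_l) : nat :=
  count (fun a => [&& k <= a, a - k \in X j, a \notin X i
                    & gaps_below X i a < gaps_below X j (a - k)]) (iota 0 M).

Lemma HL_CJ_down_up l (X : symbol l) (k M : nat) :
  0 < k -> hook_bound X <= M ->
  mset_abs (HL_CJ X) (Posz k) =
  \sum_(i < l) \sum_(j < l) (CJ_down X k M i j + CJ_up X k M i j).
Proof.
move=> k_gt0 leM; rewrite mset_abs_HL_CJ_count.
under eq_bigr do rewrite big_split /=.
rewrite big_split /= [X in _ + X]exchange_big /=.
have ltM a b i j : ((a, b, i, j) : quad l) \in CJ_hooks X -> a < M /\ b < M.
  rewrite mem_CJ_hooks => /[dup] hk; rewrite -mem_CJ_hooks => hk'.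
  have := hk'; rewrite !inE mem_hook_box => /andP[/andP[lt_a lt_b] _].
  by rewrite !(leq_trans _ leM).
pose P (h : quad l) := hook_length h == Posz k.
pose Q (h : quad l) := hook_length h == (- Posz k)%R.
transitivity (count P (CJ_hooks X) + count Q (CJ_hooks X)).
  rewrite -count_predUI [X in _ + X](eq_count (a2 := pred0)); last first.
    by move=> h /=; rewrite /P /Q; lia.
  rewrite count_pred0 addn0; apply: eq_count => h.
  by rewrite Num.Theory.eqr_norml andbT.
congr (_ + _).
  rewrite (@count_fset_quads _ _ _ (fun a => (a, a - k)) M).
  - apply: eq_bigr => i _; apply: eq_bigr => j _; apply: eq_count => a.
    rewrite mem_CJ_hooks /= /is_gap /P /=; case: (a \in X i) => /=;
    last by rewrite andbF.
    by case: (a - k \in X j) => /=; rewrite ?andbF //; lia.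
  - by move=> a b [].
  move=> [[[a b] i] j] /ltM[lt_a _]; rewrite /P /= => /eqP eq_k.
  by exists a => //; congr (_, _); lia.
rewrite (@count_fset_quads _ _ _ (fun a => (a - k, a)) M).
- apply: eq_bigr => i _; apply: eq_bigr => j _; apply: eq_count => a.
  rewrite mem_CJ_hooks /= /is_gap /Q /=; case: (a - k \in X i) => /=;
    last by rewrite andbF.
  by case: (a \in X j) => /=; rewrite ?andbF //; lia.
- by move=> a b [].
move=> [[[a b] i] j] /ltM[_ lt_b]; rewrite /Q /= => /eqP eq_k.
by exists b => //; congr (_, _); lia.
Qed.

(** * Comparing CJ-hooks and BGO-hooks *)

Lemma gaps_belowS l (X : symbol l) j b :
  gaps_below X j b.+1 = gaps_below X j b + (b \notin X j).
Proof. by rewrite /gaps_below -addn1 iotaD count_cat /= addn0 add0n. Qed.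

Lemma count_iotaS (P : pred nat) M :
  count P (iota 0 M.+1) = count P (iota 0 M) + P M.
Proof. by rewrite -addn1 iotaD count_cat /= addn0 add0n. Qed.

(** The truncated difference is - min(H(M), 0) for
H(a) = gaps_i(a) - gaps_j(a - k), and each a in [k, M) contributes its step: H
goes down at a hook of length k and up at a hook of length -k. *)
Lemma down_hooks_telescope l (X : symbol l) k M i j :
  down_hooks X k M i j =
  CJ_down X k M i j + CJ_up X k M i j
    + (gaps_below X j (M - k) - gaps_below X i M).
Proof.
rewrite /down_hooks /CJ_down /CJ_up; elim: M => [|M IHM]; first by [].
rewrite !count_iotaS IHM {IHM} gaps_belowS; have [lt_Mk|le_kM] := ltnP M k.
  have g0 : gaps_below X j 0 = 0 by [].
  by rewrite (eqnP lt_Mk) (eqnP (ltnW lt_Mk)) /= g0 !sub0n !addn0.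
rewrite subSn // gaps_belowS /=.
move: (M \in X i) (M - k \in X j) => [] [] /=; lia.
Qed.

Lemma count_fset_iota (Y : {fset nat}) (P : pred nat) M :
  (forall a, a \in Y -> a < M) ->
  count P Y = count (fun a => (a \in Y) && P a) (iota 0 M).
Proof.
move=> ltM; rewrite -!size_filter; apply/perm_size/uniq_perm.
- by rewrite filter_uniq ?fset_uniq.
- by rewrite filter_uniq ?iota_uniq.
move=> a; rewrite !mem_filter mem_iota add0n /= andbC.
by case: (boolP (a \in Y)) => //= /ltM ->; rewrite andbT.
Qed.

Lemma gaps_below_large l (X : symbol l) j M :
  (forall a, a \in X j -> a < M) -> gaps_below X j M + #|` X j| = M.
Proof.
move=> ltM; have := count_predC (is_gap X j) (iota 0 M).
rewrite size_iota => sumM; rewrite -[RHS]sumM; congr (_ + _).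
rewrite -count_predT (count_fset_iota _ ltM).
by apply: eq_count => a /=; rewrite andbT /is_gap negbK.
Qed.

Lemma mem_lt_hook_bound l (X : symbol l) j a : a \in X j -> a < hook_bound X.
Proof.
move=> aX; have := hook_in_box aX (leq_addr #|` X j| a).
by rewrite mem_hook_box andbb.
Qed.

(** Beyond the largest entry the numbers of gaps are known from the charges,
which turns the discrepancy of [down_hooks_telescope] into n_i - n_j - k. *)
Lemma HL_BGO_CJ l (X : symbol l) (k : nat) : 0 < k ->
  HL_BGO X (Posz k) =
  mset_abs (HL_CJ X) (Posz k)
    + \sum_(i < l) \sum_(j < l) (#|` X i| - (#|` X j| + k)).
Proof.
move=> k_gt0; pose M := hook_bound X + k.
have lt_bound j a : a \in X j -> a < hook_bound X by apply: mem_lt_hook_bound.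
have le_bound : hook_bound X <= M by rewrite leq_addr.
rewrite (HL_BGO_down_hooks k_gt0 le_bound) (HL_CJ_down_up k_gt0 le_bound).
rewrite -big_split /=; apply: eq_bigr => i _.
rewrite -big_split /=; apply: eq_bigr => j _.
rewrite down_hooks_telescope addnK; congr (_ + _).
have gapsj := gaps_below_large (@lt_bound j).
have gapsi : gaps_below X i M + #|` X i| = M.
  by apply: gaps_below_large => a /lt_bound/leq_trans; apply.
by move: gapsi gapsj; rewrite /M /=; lia.
Qed.

Lemma card_empty_symbol l (n : 'I_l -> nat) j : #|` empty_symbol n j| = n j.
Proof.
rewrite ffunE card_fseq undup_id ?size_iota ?iota_uniq //.
Qed.

Lemma HL_CJ_empty l (n : 'I_l -> nat) x :
  mset_abs (HL_CJ (empty_symbol n)) x = 0.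
Proof.
rewrite mset_abs_HL_CJ_count; apply/eqP.
rewrite -leqn0 leqNgt -has_count.
apply/hasPn => -[[[a b] i] j]; rewrite mem_CJ_hooks => /andP[/andP[aX _]].
suff -> : gaps_below (empty_symbol n) i a = 0 by [].
apply/eqP; rewrite -leqn0 leqNgt -has_count; apply/hasPn => c.
move: aX; rewrite /is_gap !ffunE !inE !mem_iota !add0n /= negbK => lt_an lt_ca.
exact: ltn_trans lt_ca lt_an.
Qed.

Lemma HL_CJ_BGO_empty l (X : symbol l) (k : nat) : 0 < k ->
  mset_abs (HL_CJ X) (Posz k) + HL_BGO (empty_symbol (multicharge X)) (Posz k)
  = HL_BGO X (Posz k).
Proof.
move=> k_gt0; rewrite !HL_BGO_CJ // HL_CJ_empty add0n; congr (_ + _).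
apply: eq_bigr => i _; apply: eq_bigr => j _.
by rewrite !card_empty_symbol !ffunE.
Qed.

(** * Convexity of the truncated difference *)

(** The graph of [g] lies above its chord through A and A + 1, extended to a
line: g x >= g A + (x - A) (g (A + 1) - g A), rearranged so that no
subtraction remains. *)
Definition discrete_convex (g : nat -> nat) : Prop :=
  forall A x, g A + x * g A.+1 + A * g A <= g x + x * g A + A * g A.+1.

Lemma discrete_convex_subl c : discrete_convex (fun x => x - c).
Proof.
move=> A x /=; have [le_cA|lt_Ac] := leqP c A.
  rewrite subSn // !mulnS; nia.
have -> : A - c = 0 by lia.
have -> : A.+1 - c = 0 by lia.
by rewrite !muln0.
Qed.

Lemma discrete_convex_subr c : discrete_convex (fun x => c - x).
Proof.
move=> A x /=; have [le_cA|lt_Ac] := leqP c A.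
  have -> : c - A = 0 by lia.
  have -> : c - A.+1 = 0 by lia.
  by rewrite !muln0.
have [d ->] : exists d, c = (d + A).+1 by exists (c - A.+1); lia.
have -> : (d + A).+1 - A = d.+1 by lia.
have -> : (d + A).+1 - A.+1 = d by lia.
rewrite !mulnS; nia.
Qed.

Lemma discrete_convex_sum (I : finType) (g : I -> nat -> nat) :
  (forall i, discrete_convex (g i)) ->
  discrete_convex (fun x => \sum_i g i x).
Proof.
move=> cvx A x; rewrite !big_distrr -!big_split /=.
by apply: leq_sum => i _; apply: cvx.
Qed.

(** Jensen's inequality for integers. The values of a balanced family are A or
A + 1, where A is the smallest one, and there the chord bound of
[discrete_convex] is an equality; the other family satisfies the same bound
summed up, which depends only on the sum of its values. *)
Lemma balanced_min_sum (I : finType) (g : nat -> nat) (p po : I -> nat) :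
  discrete_convex g -> \sum_i p i = \sum_i po i ->
  (forall i j, po i <= (po j).+1) -> \sum_i g (po i) <= \sum_i g (p i).
Proof.
move=> cvx eq_sum bal; have [i0|I0] := pickP (fun _ : I => true); last first.
  by rewrite !big1 // => i; have := I0 i.
have [i1 minA] : exists i1, forall i, po i1 <= po i.
  have [i1 _ min1] := arg_minnP po (isT : predT i0).
  by exists i1 => i; exact: min1 i isT.
set A := po i1 in minA.
have : \sum_i (g A + p i * g A.+1 + A * g A)
         <= \sum_i (g (p i) + p i * g A + A * g A.+1).
  by apply: leq_sum => i _; apply: cvx.
have : \sum_i (g A + po i * g A.+1 + A * g A)
         = \sum_i (g (po i) + po i * g A + A * g A.+1).
  apply: eq_bigr => i _; have := minA i; have := bal i i1; rewrite -/A.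
  rewrite leq_eqVlt ltnS => /predU1P[-> _|le1 le2]; first by rewrite !mulSn; lia.
  by have -> : po i = A; [lia | rewrite addnAC].
by rewrite !big_split /= -!big_distrl /= eq_sum => -> ; rewrite !leq_add2r.
Qed.

(** Replacing first the q_j, then the p_i, by balanced families with the same sum
cannot increase the double sum, as the truncated difference is convex in either
argument. *)
Lemma balanced_min_excess l (t : nat) (p q po qo : 'I_l -> nat) :
  \sum_i p i = \sum_i po i -> \sum_j q j = \sum_j qo j ->
  (forall i j, po i <= (po j).+1) -> (forall i j, qo i <= (qo j).+1) ->
  \sum_(i < l) \sum_(j < l) (po i - (t + qo j)) <=
  \sum_(i < l) \sum_(j < l) (p i - (t + q j)).
Proof.
move=> eqp eqq balp balq.
apply: (@leq_trans (\sum_(i < l) \sum_(j < l) (p i - (t + qo j)))).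
  apply: (balanced_min_sum (g := fun x => \sum_(j < l) (x - (t + qo j)))) => //.
  by apply: discrete_convex_sum => j; apply: discrete_convex_subl.
rewrite exchange_big [X in _ <= X]exchange_big /=.
apply: (balanced_min_sum (g := fun y => \sum_(i < l) (p i - (t + y)))) => //.
apply: discrete_convex_sum => i A x.
by rewrite !subnDA; apply: discrete_convex_subr.
Qed.

(** * The e-core *)

(** The operations move a bead between components either at the same position or
by e, hence preserve the total of any e-periodic weight. *)
Lemma core_step_sum e l (c : nat -> nat) (X Y : symbol l) :
  (forall a, e <= a -> c (a - e) = c a) -> core_step e X Y ->
  \sum_(k < l) \sum_(x <- Y k) c x = \sum_(k < l) \sum_(x <- X k) c x.
Proof.
move=> per; case=> [a i j _ hk|a i j _ _ le_ea hk];
  have := move_measure (fun x _ => c x) hk; first by move/addIn.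
by rewrite per // => /addIn.
Qed.

Lemma ecore_sum e l (c : nat -> nat) (X Xo : symbol l) :
  (forall a, e <= a -> c (a - e) = c a) -> is_ecore_of e X Xo ->
  \sum_(k < l) \sum_(x <- Xo k) c x = \sum_(k < l) \sum_(x <- X k) c x.
Proof.
move=> per [+ _]; elim=> [Y Z /core_step_sum -> //|//|Y Z W _ <- _ <- //].
Qed.

Lemma ecore_nested e l (X Xo : symbol l) (i j : 'I_l) a :
  is_ecore_of e X Xo -> i <= j -> a \in Xo i -> a \in Xo j.
Proof.
move=> [_ stuck] le_ij aXi; apply: contraT => aXj.
move: le_ij; rewrite leq_eqVlt => /predU1P[/val_inj eq_ij|lt_ij].
  by rewrite -eq_ij aXi in aXj.
have hk : is_hook Xo (a, a, i, j) by apply/andP.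
by case: (stuck _ (core_step_up e lt_ij hk)).
Qed.

(** If a lies in Xo_i, it lies in the last component by nesting; the wrapping
operation being impossible, a - e lies in the first one, hence in all. In
particular each component meets each residue class in an initial segment. *)
Lemma ecore_shift e l (X Xo : symbol l) (i j : 'I_l) a :
  is_ecore_of e X Xo -> a \in Xo i -> e <= a -> a - e \in Xo j.
Proof.
move=> Xcore aXi le_ea; have [_ stuck] := Xcore.
have l_gt0 : 0 < l by apply: leq_ltn_trans (ltn_ord i).
have lt_last : l.-1 < l by rewrite prednK.
pose last := Ordinal lt_last; pose first := Ordinal l_gt0.
have aXl : a \in Xo last.
  by apply: ecore_nested Xcore _ aXi; rewrite -ltnS prednK.
apply: (ecore_nested Xcore (leq0n j : first <= j)).
apply: contraT => aXf.
have hk : is_hook Xo (a, a - e, last, first) by apply/andP.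
have el : val last = l.-1 by [].
have ef : val first = 0 by [].
by case: (stuck _ (core_step_wrap el ef le_ea hk)).
Qed.

Lemma shift_closed_mod e (Q : pred nat) a b :
  (forall x, Q x -> e <= x -> Q (x - e)) ->
  Q a -> b <= a -> b = a %[mod e] -> Q b.
Proof.
move=> Qe Qa le_ba /eqP; rewrite eq_sym eqn_mod_dvd // => /dvdnP[m def_m].
have : Q (b + m * e) by rewrite -def_m subnKC.
elim: m {def_m} => [|m IHm]; first by rewrite addn0.
by move/Qe; rewrite mulSn addnCA leq_addr addKn => /(_ isT).
Qed.

Lemma sum_bool_count (T : Type) (P : pred T) (s : seq T) :
  \sum_(x <- s) P x = count P s.
Proof.
by rewrite -sum1_count [RHS]big_mkcond; apply: eq_bigr => x _; case: (P x).
Qed.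

Lemma count_diff_ge (T : Type) (A B : pred T) (s : seq T) :
  count A s - count B s <= count (fun x => A x && ~~ B x) s.
Proof.
rewrite leq_subLR -count_predUI; apply: leq_trans (leq_addr _ _).
by apply: sub_count => x /= ->; case: (B x).
Qed.

(** Two sets stable under x |-> x - e are initial segments of a residue class
modulo e, hence comparable there, so that the bound of [count_diff_ge] is
attained. *)
Lemma count_diff_nested e (r : nat) (A B : pred nat) (s : seq nat) :
  (forall x, A x -> e <= x -> A (x - e)) ->
  (forall x, B x -> e <= x -> B (x - e)) ->
  count (fun x => [&& x %% e == r, A x & ~~ B x]) s =
  count (fun x => (x %% e == r) && A x) s
    - count (fun x => (x %% e == r) && B x) s.
Proof.
move=> Ae Be.
have [/hasP[b sb /and3P[rb Bb nAb]]|/hasPn AsubB] :=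
  boolP (has (fun x => [&& x %% e == r, B x & ~~ A x]) s).
  have BsubA x : x %% e == r -> A x -> B x.
    move=> rx Ax; have [le_xb|/ltnW le_bx] := leqP x b.
      by apply: shift_closed_mod Be Bb le_xb _; rewrite (eqP rx) (eqP rb).
    case/negP: nAb; apply: shift_closed_mod Ae Ax le_bx _.
    by rewrite (eqP rx) (eqP rb).
  rewrite (@eq_count _ _ pred0) => [|x /=]; last first.
    by case: eqP => //= /eqP rx; case: (boolP (A x)) => //= /(BsubA x rx) ->.
  rewrite count_pred0; apply/esym/eqP; rewrite subn_eq0; apply: sub_count => x /=.
  by move=> /andP[rx Ax]; rewrite rx BsubA.
apply: (canRL (addnK _)).
rewrite -count_predUI [X in _ + X](@eq_count _ _ pred0) => [|x /=]; last first.
  by case: (B x); rewrite ?andbF.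
rewrite count_pred0 addn0; apply: eq_in_count => x /AsubB /=.
by case: eqP => //= _; case: (A x) (B x) => [] [].
Qed.

Lemma count_residue_le1 e r k :
  count (fun x => (x + k) %% e == r) (iota 0 e) <= 1.
Proof.
have [/hasP[b]|/hasPn no] :=
  boolP (has (fun x => (x + k) %% e == r) (iota 0 e)).
  rewrite mem_iota => /andP[_ lt_be] /eqP br.
  rewrite (@eq_in_count _ _ (pred1 b)) ?count_uniq_mem ?iota_uniq ?leq_b1 //.
  move=> x; rewrite mem_iota => /andP[_ lt_xe] /=.
  by rewrite -br eqn_modDr !modn_small.
by rewrite (@eq_in_count _ _ pred0) ?count_pred0 // => x /no /negPf.
Qed.

Lemma count_iota_shift (P : pred nat) d n :
  count P (iota d n) = count (fun x => P (x + d)) (iota 0 n).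
Proof.
rewrite -[d in iota d]addn0 iotaDl count_map.
by apply: eq_count => x /=; rewrite addnC.
Qed.

(** By [ecore_shift], subtracting e injects the elements >= e of the class in one
component into any other component; at most one element of the class is < e.
The shift k lets the same statement serve the entries of X_j + k. *)
Lemma ecore_balanced e l (X Xo : symbol l) k r (i j : 'I_l) :
  is_ecore_of e X Xo ->
  count (fun x => (x + k) %% e == r) (Xo i) <=
  (count (fun x => (x + k) %% e == r) (Xo j)).+1.
Proof.
move=> core; set P := fun x => _; pose N := hook_bound Xo.
have ltN j' a : a \in Xo j' -> a < N by apply: mem_lt_hook_bound.
rewrite (@count_fset_iota (Xo i) _ (e + N)); last first.
  by move=> a /ltN/leq_trans; apply; apply: leq_addl.
rewrite (count_fset_iota _ (@ltN j)) iotaD count_cat -add1n leq_add //.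
  apply: leq_trans (count_residue_le1 e r k).
  by apply: sub_count => x /andP[].
rewrite count_iota_shift; apply: sub_count => x /andP[aXo].
rewrite /P add0n addnAC modnDr => ->; rewrite andbT.
by have := ecore_shift j core aXo (leq_addl _ _); rewrite addnK.
Qed.

(** * BGO-hooks of the e-core *)

(** Compared one residue class at a time: the truncated differences of
[count_diff_ge] bound the count for X from below and equal the count for Xo, and
their double sum is smallest for Xo by [balanced_min_excess]. *)
Lemma ecore_down_hooks e l (X Xo : symbol l) k M :
  0 < e -> is_ecore_of e X Xo ->
  hook_bound X + k <= M -> hook_bound Xo + k <= M ->
  \sum_(i < l) \sum_(j < l) down_hooks Xo k M i j <=
  \sum_(i < l) \sum_(j < l) down_hooks X k M i j.
Proof.
move=> e_gt0 core leX leXo.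
pose p (Z : symbol l) r (i : 'I_l) :=
   count (fun a => (a %% e == r) && (a \in Z i)) (iota 0 M).
pose t r := count (fun a => (a %% e == r) && (a < k)) (iota 0 M).
pose q (Z : symbol l) r (j : 'I_l) :=
   count (fun a => [&& a %% e == r, k <= a & a - k \in Z j]) (iota 0 M).
(* No hook of length k leads from a position in B down to a gap of Z_j. The part
   a < k of B, counted by t, depends neither on j nor on Z. *)
pose B (Z : symbol l) j a := (a < k) || (a - k \in Z j).
have tqE Z r j :
    t r + q Z r j = count (fun a => (a %% e == r) && B Z j a) (iota 0 M).
  rewrite /t /q -count_predUI.
  rewrite [X in _ + X](@eq_count _ _ pred0) => [|a /=]; last first.
    by rewrite ltnNge; case: (k <= a); rewrite ?andbF.
  rewrite count_pred0 addn0; apply: eq_count => a /=.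
  by rewrite /B ltnNge; case: (k <= a); rewrite ?andbF ?andbT ?orbF.
have splitE Z i j : down_hooks Z k M i j = \sum_(r < e)
   count (fun a => [&& a %% e == r, a \in Z i & ~~ B Z j a]) (iota 0 M).
  rewrite /down_hooks -sum1_count big_mkcond.
  under [RHS]eq_bigr do rewrite -sum1_count big_mkcond.
  rewrite exchange_big; apply: eq_bigr => a _ /=.
  rewrite (bigD1 (Ordinal (ltn_pmod a e_gt0))) //= eqxx /= big1 => [|r].
    by rewrite addn0 /B negb_or -leqNgt andbCA.
  by rewrite -val_eqE /= eq_sym => /negPf ->.
have sumE F : \sum_(i < l) \sum_(j < l) \sum_(r < e) F i j r
            = \sum_(r < e) \sum_(i < l) \sum_(j < l) (F i j r : nat).
  by under eq_bigr do rewrite exchange_big; rewrite exchange_big.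
under eq_bigr do under eq_bigr do rewrite splitE.
under [leqRHS]eq_bigr do under eq_bigr do rewrite splitE.
rewrite !sumE; apply: leq_sum => r _.
apply: (@leq_trans
  (\sum_(i < l) \sum_(j < l) (p X r i - (t r + q X r j)))); last first.
  apply: leq_sum => i _; apply: leq_sum => j _; rewrite tqE.
  apply: leq_trans (count_diff_ge _ _ _) _; apply: sub_count => a /=.
  by case: eqP.
have coreE i j :
    count (fun a => [&& a %% e == r, a \in Xo i & ~~ B Xo j a]) (iota 0 M)
      = p Xo r i - (t r + q Xo r j).
  rewrite tqE; apply: count_diff_nested => a.
    by move=> aXo; apply: ecore_shift core aXo.
  rewrite /B => /orP[lt_ak|aXo] le_ea.
    by rewrite (leq_ltn_trans (leq_subr e a) lt_ak).
  have [//|le_kae /=] := ltnP (a - e) k.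
  rewrite subnAC; apply: ecore_shift core aXo _; lia.
under eq_bigr do under eq_bigr do rewrite coreE.
have bound (Z : symbol l) i a : hook_bound Z + k <= M -> a \in Z i -> a + k < M.
  move=> leM /mem_lt_hook_bound lt_a; apply: leq_trans leM.
  by rewrite -addSn leq_add2r.
have pE Z i : hook_bound Z + k <= M ->
    p Z r i = \sum_(x <- Z i) (x %% e == r).
  move=> leM; rewrite sum_bool_count (@count_fset_iota _ _ M).
    by apply: eq_count => a; rewrite andbC.
  by move=> a /(bound _ _ _ leM); apply: leq_ltn_trans (leq_addr _ _).
have qE Z j : hook_bound Z + k <= M ->
    q Z r j = \sum_(x <- Z j) ((x + k) %% e == r).
  move=> leM; have le_kM : k <= M by apply: leq_trans leM; apply: leq_addl.
  rewrite sum_bool_count.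
  rewrite (@count_fset_iota _ _ (M - k)); last first.
    by move=> a /(bound _ _ _ leM); rewrite ltn_subRL addnC.
  rewrite /q -{1}(subnKC le_kM) iotaD count_cat.
  rewrite (@eq_in_count _ _ pred0) ?count_pred0 => [|a]; last first.
    by rewrite mem_iota add0n /= => lt_ak; rewrite [k <= a]leqNgt lt_ak andbF.
  rewrite add0n count_iota_shift; apply: eq_count => a /=.
  by rewrite leq_addl addnK andbC.
apply: balanced_min_excess.
- under eq_bigr do rewrite pE //.
  under [RHS]eq_bigr do rewrite pE //.
  symmetry; apply: ecore_sum core => a le_ea.
  by rewrite -[in RHS](subnK le_ea) modnDr.
- under eq_bigr do rewrite qE //.
  under [RHS]eq_bigr do rewrite qE //.
  symmetry; apply: ecore_sum core => a le_ea.
  by rewrite -[in RHS](subnK le_ea) addnAC modnDr.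
- move=> i j; rewrite !pE // !sum_bool_count.
  have := ecore_balanced 0 r i j core.
  under eq_count do rewrite addn0.
  by under [X in _ <= X.+1]eq_count do rewrite addn0.
- move=> i j; rewrite !qE // !sum_bool_count.
  exact: ecore_balanced core.
Qed.

Lemma ecore_HL_BGO e l (X Xo : symbol l) k :
  0 < e -> is_ecore_of e X Xo -> 0 < k ->
  HL_BGO Xo (Posz k) <= HL_BGO X (Posz k).
Proof.
move=> e_gt0 core k_gt0; pose M := maxn (hook_bound X) (hook_bound Xo) + k.
have leX : hook_bound X + k <= M by rewrite leq_add2r leq_maxl.
have leXo : hook_bound Xo + k <= M by rewrite leq_add2r leq_maxr.
have leX' := leq_trans (leq_addr k _) leX.
have leXo' := leq_trans (leq_addr k _) leXo.
rewrite (HL_BGO_down_hooks k_gt0 leX') (HL_BGO_down_hooks k_gt0 leXo').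
exact: ecore_down_hooks core leX leXo.
Qed.

(** * The containment *)

Lemma HL_BGO_neg l (X : symbol l) n : HL_BGO X (Negz n) = 0.
Proof.
rewrite HL_BGO_count; apply/eqP.
rewrite -leqn0 leqNgt -has_count.
apply/hasPn => -[[[a b] i] j]; rewrite mem_BGO_hooks => /and3P[_ le_ba _].
by rewrite /hook_length; lia.
Qed.

Lemma mset_abs_neg (A : {mset int}) n : mset_abs A (Negz n) = 0.
Proof.
rewrite /mset_abs mset_seqE count_map; apply/eqP.
rewrite -leqn0 leqNgt -has_count.
by apply/hasPn => x _ /=; lia.
Qed.

(** A hook (a, a, i, j) of an e-core has i > j by nesting, and then Xo_j is
contained in Xo_i, so that Xo_i has at most as many gaps below a as Xo_j. *)
Lemma ecore_HL_CJ_zero e l (X Xo : symbol l) :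
  is_ecore_of e X Xo -> mset_abs (HL_CJ Xo) (Posz 0) = 0.
Proof.
move=> core; rewrite mset_abs_HL_CJ_count; apply/eqP.
rewrite -leqn0 leqNgt -has_count.
apply/hasPn => -[[[a b] i] j]; rewrite mem_CJ_hooks => /andP[/andP[aXi bXj]].
rewrite ltnNge; apply: contra.
rewrite Num.Theory.normr_eq0 /hook_length => eq_ab.
have {eq_ab} eq_ab : a = b by lia.
rewrite -eq_ab in bXj *; apply: sub_count => c; apply: contra => cXj.
have [le_ij|/ltnW le_ji] := leqP i j; last exact: ecore_nested core le_ji cXj.
by case/negP: bXj; apply: ecore_nested core le_ij aXi.
Qed.

Lemma ecore_contained e l (X Xo : symbol l) :
  0 < e -> is_ecore_of e X Xo ->
  (mset_nonzero
     (mset_abs (HL_CJ Xo) `+` HL_BGO (empty_symbol (multicharge Xo)))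
   `<=`
   mset_abs (HL_CJ X) `+` HL_BGO (empty_symbol (multicharge X)))%mset.
Proof.
move=> e_gt0 core; apply/msubsetP => x; rewrite mset_nonzeroE.
case: x => [[|k]|n] /=; rewrite ?msetE2 //.
  by rewrite !HL_CJ_BGO_empty //; apply: ecore_HL_BGO core _.
by rewrite !HL_BGO_neg !mset_abs_neg.
Qed.

Lemma HL_BGO_empty_const l (n : 'I_l -> nat) m k :
  0 < k -> (forall j, n j = m) -> HL_BGO (empty_symbol n) (Posz k) = 0.
Proof.
move=> k_gt0 nm; rewrite HL_BGO_CJ // HL_CJ_empty add0n.
rewrite big1 // => i _; rewrite big1 // => j _.
by rewrite !card_empty_symbol !nm; lia.
Qed.

Lemma part_antitone p i j : is_partition p -> i <= j -> part p j <= part p i.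
Proof.
move=> /andP[sorted_p _] le_ij; rewrite /part.
have [le_pj|lt_jp] := leqP (size p) j.-1; first by rewrite nth_default.
apply: (sorted_leq_nth _ _ 0 sorted_p) => //.
- by move=> y x z le_yx le_zy; apply: leq_trans le_zy le_yx.
- exact: leqnn.
- by rewrite inE; lia.
lia.
Qed.

Lemma shift_bset0 (Y : {fset nat}) : shift_bset Y 0 = Y.
Proof.
apply/fsetP => x; rewrite !inE /=; apply/imfsetP/idP => [[y yY ->]|xY].
  by rewrite addn0.
by exists x; rewrite ?addn0.
Qed.

(** The entries part_i + m - i decrease strictly with i, hence there are m of
them. *)
Lemma multicharge_symbol_of0 l (lam : 'I_l -> seq nat) j :
  is_partition (lam j) ->
  multicharge (symbol_of (fun=> 0) lam) j = base_charge lam.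
Proof.
move=> partj; rewrite !ffunE shift_bset0; set m := base_charge lam.
rewrite card_in_imfset /=.
  by rewrite undup_id ?size_iota ?iota_uniq.
move=> i i'; rewrite !mem_iota.
wlog le_ii : i i' / i <= i'.
  by move=> th; case/orP: (leq_total i i') => le ? ? eq; [|symmetry]; apply: th.
have := part_antitone partj le_ii; lia.
Qed.

Theorem proposition2p3p9 (e l : nat) (he : 0 < e) (hl : 0 < l)
    (lam : 'I_l -> seq nat) (hlam : forall j : 'I_l, is_partition (lam j)) :
  (forall (s : 'I_l -> nat) (Xo : symbol l),
     is_ecore_of e (symbol_of s lam) Xo ->
     (mset_nonzero
        (mset_abs (HL_CJ Xo) `+` HL_BGO (empty_symbol (multicharge Xo)))
      `<=`
      mset_abs (HL_CJ (symbol_of s lam))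
        `+` HL_BGO (empty_symbol (multicharge (symbol_of s lam))))%mset)
  /\
  (forall Xo : symbol l,
     is_ecore_of e (symbol_of (fun _ : 'I_l => 0) lam) Xo ->
     (mset_abs (HL_CJ Xo)
      `<=` mset_abs (HL_CJ (symbol_of (fun _ : 'I_l => 0) lam)))%mset).
Proof.
split=> [s Xo core|Xo core]; first exact: ecore_contained core.
apply/msubsetP => -[[|k]|n]; last by rewrite !mset_abs_neg.
  by rewrite (ecore_HL_CJ_zero core).
have /msubsetP/(_ (Posz k.+1)) := ecore_contained he core.
rewrite mset_nonzeroE /= !msetE2.
rewrite [X in _ <= _ + X](@HL_BGO_empty_const _ _ (base_charge lam)) // => [|j].
  by rewrite addn0; apply: leq_trans (leq_addr _ _).
exact: multicharge_symbol_of0.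
Qed.
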